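(* Let $\Phi$ be an irreducible reduced root system with Weyl group $W$, basis $\Delta$, highest root $\tilde\alpha$, and let $\tilde I$, $X_{\tilde I}$, $x_\alpha$, $L$, $\preceq$, $\xrightarrow{\gamma}$ be as in the context. Then the map $X_{\tilde I}\to\Phi_{\mathrm{lg}}$, $x\mapsto x(\tilde\alpha)$, is a bijection which is an anti-isomorphism of posets between $(\Phi_{\mathrm{lg}},\preceq)$ and $(X_{\tilde I},\le)$ (Bruhat order), and a long root of level $i$ corresponds to an element of length $i$. For long roots $\alpha,\beta$ and a positive root $\gamma$, we have $\beta\xrightarrow{\gamma}\alpha$ if and only if $x_\beta\xrightarrow{\gamma}x_\alpha$. Moreover, in this situation the integer $\partial_{\alpha\beta}:=\langle\beta,\gamma^\vee\rangle$ is given as follows: (i) if $\beta\in\Delta_{\mathrm{lg}}$ and $\alpha\in-\Delta_{\mathrm{lg}}$, then $\partial_{\alpha\beta}=2$ if $\alpha=-\beta$, and $\partial_{\alpha\beta}=1$ if $\beta+(-\alpha)$ is a root; (ii) otherwise, $\partial_{\alpha\beta}=1$ if $\gamma$ is long and $\partial_{\alpha\beta}=r$ if $\gamma$ is short.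
   Context: $\Phi$ is an irreducible reduced root system in a real vector space $V$, with coroots $\alpha^\vee$, pairing $\langle\cdot,\cdot\rangle$, reflections $s_\alpha$, Weyl group $W$. Fix a $W$-invariant scalar product $(\cdot|\cdot)$ with $\min_{\alpha\in\Phi}(\alpha|\alpha)=1$ and let $r=\max_{\alpha\in\Phi}(\alpha|\alpha)$; $\Phi_{\mathrm{lg}}=\{\alpha:(\alpha|\alpha)=r\}$ (long roots), short roots are the others; $\Delta_{\mathrm{lg}}=\Delta\cap\Phi_{\mathrm{lg}}$, $\Delta_{\mathrm{sh}}=\Delta\setminus\Delta_{\mathrm{lg}}$; $\Phi^+$ the positive roots; $l$ the length function for simple reflections $s_\alpha$, $\alpha\in\Delta$. $\tilde I=\{\alpha\in\Delta:(\tilde\alpha|\alpha)=0\}$, $\Phi_{\tilde I}^+$ the positive roots in the span of $\tilde I$, $X_{\tilde I}=\{w\in W:w(\Phi^+_{\tilde I})\subset\Phi^+\}$, and for $\alpha\in\Phi_{\mathrm{lg}}$, $x_\alpha$ is the unique element of $X_{\tilde I}$ with $x_\alpha(\tilde\alpha)=\alpha$. For a long root $\gamma=\sum_{\alpha\in\Delta}n_\alpha\alpha$, $\mathrm{ht}^\vee(\gamma)=\sum_{\alpha\in\Delta_{\mathrm{lg}}}n_\alpha+\frac1r\sum_{\alpha\in\Delta_{\mathrm{sh}}}n_\alpha$. Level: $L(\alpha)=\mathrm{ht}^\vee(\tilde\alpha)-\mathrm{ht}^\vee(\alpha)$ if $\alpha>0$, $L(\alpha)=\mathrm{ht}^\vee(\tilde\alpha)-\mathrm{ht}^\vee(\alpha)-1$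 if $\alpha<0$. For long roots $\alpha,\beta$ and $\gamma\in\Phi^+$: $\beta\xrightarrow{\gamma}\alpha$ means $\alpha=s_\gamma(\beta)$ and $L(\alpha)=L(\beta)+1$. A path from $\beta$ to $\alpha$ is a sequence of long roots $\beta=\beta_0\xrightarrow{\gamma_1}\beta_1\xrightarrow{\gamma_2}\cdots\xrightarrow{\gamma_k}\beta_k=\alpha$ with $\gamma_i\in\Phi^+$; $\alpha\preceq\beta$ means there is a path from $\beta$ to $\alpha$. For $w,w'\in W$ and $\gamma\in\Phi^+$, $w\xrightarrow{\gamma}w'$ means $w'=s_\gamma w$ and $l(w')=l(w)+1$; the Bruhat order $\le$ is the reflexive transitive closure of these relations, restricted to $X_{\tilde I}$. *)

(* Defs.v *)
From mathcomp Require Import all_boot all_order all_algebra.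
From Stdlib Require Import Relations.
Set Implicit Arguments.
Unset Strict Implicit.
Unset Printing Implicit Defensive.
Import Order.TTheory GRing.Theory Num.Theory.
Local Open Scope ring_scope.

Section RootSystems.
Variables (R : realFieldType) (n : nat).
Local Notation V := 'rV[R]_n.

(* coroots: cor a : 'cV_n is the linear form a^\vee : x |-> (x *m cor a) 0 0 *)
Variable cor : V -> 'cV[R]_n.
Variable Phi : seq V.

Definition cpair (x a : V) : R := (x *m cor a) 0 0.

Definition act (w : 'M[R]_n) (x : V) : V := x *m w.

Definition refl_mx (a : V) : 'M[R]_n := 1%:M - cor a *m a.

Lemma act_refl_mx a x : act (refl_mx a) x = x - cpair x a *: a.
Proof.
rewrite /act /refl_mx mulmxBr mulmx1 mulmxA; congr (_ - _).
by rewrite [x *m cor a]mx11_scalar mul_scalar_mx.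
Qed.

Definition is_intR (x : R) := exists k : int, x = k%:~R.

Definition root_system :=
  [/\ (<<Phi>>%VS = fullv),
      (0 : V) \notin Phi,
      (forall a, a \in Phi -> cpair a a = 2),
      (forall a b, a \in Phi -> b \in Phi -> act (refl_mx a) b \in Phi)
    & (forall a b, a \in Phi -> b \in Phi -> is_intR (cpair b a))].

Definition reduced_rs :=
  forall (a : V) (c : R), a \in Phi -> c *: a \in Phi -> c = 1 \/ c = -1.

Definition irreducible_rs :=
  ~ exists P : pred V,
      [/\ exists2 a, a \in Phi & P a,
          exists2 a, a \in Phi & ~~ P a
        & forall a b, a \in Phi -> b \in Phi -> P a -> ~~ P b ->
            cpair a b = 0 /\ cpair b a = 0].

Inductive in_W : 'M[R]_n -> Prop :=
| W_one : in_W 1%:M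
| W_step w a : in_W w -> a \in Phi -> in_W (w *m refl_mx a). (* = s_a o w *)

Variable Q : 'M[R]_n.
Definition sp (x y : V) : R := (x *m Q *m y^T) 0 0.

Definition W_invariant_scalar_product :=
  [/\ Q^T = Q,
      (forall x : V, x != 0 -> 0 < sp x x)
    & (forall w x y, in_W w -> sp (act w x) (act w y) = sp x y)].

Definition min_sp_one :=
  (forall a, a \in Phi -> 1 <= sp a a) /\ (exists2 a, a \in Phi & sp a a = 1).

Definition rmax : R := \big[Num.max/0]_(a <- Phi) sp a a.

Definition longb (a : V) : bool := (a \in Phi) && (sp a a == rmax).

Variable Delta : n.-tuple V.

Definition simple_basis :=
  [/\ free Delta,
      (forall i, tnth Delta i \in Phi)
    & (forall a, a \in Phi ->
         (forall i, exists k : nat, coord Delta i a = k%:R) \/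
         (forall i, exists k : nat, coord Delta i a = - k%:R))].

Definition posb (a : V) : bool := [forall i, 0 <= coord Delta i a].

Definition highest_root (ht : V) :=
  ht \in Phi /\ forall b, b \in Phi -> forall i, coord Delta i b <= coord Delta i ht.

Definition simple_word (k : nat) (w : 'M[R]_n) :=
  exists s : seq 'I_n, size s = k /\
    w = foldr (fun i M => M *m refl_mx (tnth Delta i)) 1%:M s.

Definition is_length (w : 'M[R]_n) (k : nat) :=
  simple_word k w /\ forall j, (j < k)%N -> ~ simple_word j w.

Definition htv (a : V) : R :=
  \sum_(i < n | longb (tnth Delta i)) coord Delta i a
  + rmax^-1 * \sum_(i < n | ~~ longb (tnth Delta i)) coord Delta i a.

Variable ht : V.

Definition level (a : V) : R :=
  if posb a then htv ht - htv a else htv ht - htv a - 1.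

Definition root_arrow (g b a : V) :=
  [/\ longb a, longb b, a = act (refl_mx g) b & level a = level b + 1].

Definition root_prec (a b : V) :=
  clos_refl_trans V (fun x y => exists g, [/\ g \in Phi, posb g & root_arrow g x y]) b a.

Definition W_arrow (g : V) (w w' : 'M[R]_n) :=
  w' = w *m refl_mx g /\ exists k, is_length w k /\ is_length w' k.+1.

Definition bruhat_le (w w' : 'M[R]_n) :=
  clos_refl_trans _ (fun u v => exists g, [/\ g \in Phi, posb g & W_arrow g u v]) w w'.

Definition Itilde : seq V := [seq a <- (Delta : seq V) | sp ht a == 0].

Definition pos_root_I (a : V) := [/\ a \in Phi, posb a & a \in <<Itilde>>%VS].

Definition XI (w : 'M[R]_n) :=
  in_W w /\ forall a, pos_root_I a -> (act w a \in Phi) && posb (act w a).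

Definition Delta_lg (a : V) : bool := (a \in (Delta : seq V)) && longb a.

End RootSystems.

(* Main.v *)
(* For a dominant long root the difference to the highest root [ht] pairs nonnegatively with
   both, which forces equality; hence all long roots lie in the orbit of [ht], and walking up
   to [ht] by simple reflections yields representatives in [X]. Such a reflection s_i moves a
   long root b by 1 in level when (b|alpha_i) > 0, and multiplies its representative by one
   letter, so level = length.
   For an arrow b -> a = s_g b one has (b|g) > 0; write s_g x_a = x_b v with v fixing [ht]. By
   the exchange condition s_g x_a is shorter than x_a, while lengths add up in x_b v, so v = 1.
   A Bruhat step w -> s_g w maps under w |-> w [ht] to b -> s_g b with (b|g) >= 0, and such a
   pair is joined by a path of arrows: lower s_g b by a simple reflection s_i, use induction on
   the level, and lift the path back with the operation x |-> max(x, s_i x), which preserves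
   paths. *)

Require Import Defs.
From mathcomp Require Import all_boot all_order all_algebra.
From mathcomp Require Import zify ring lra.
From Stdlib Require Import Relations.
Import Order.TTheory GRing.Theory Num.Theory.
Local Open Scope ring_scope.
Set Implicit Arguments.
Unset Strict Implicit.
Unset Printing Implicit Defensive.

Section LongRoots.
Variables (R : realFieldType) (n : nat).
Local Notation V := 'rV[R]_n.
Variables (cor : V -> 'cV[R]_n) (Phi : seq V) (Q : 'M[R]_n).
Variables (Delta : n.-tuple V) (ht : V).
Hypothesis rsP : root_system cor Phi.
Hypothesis redP : reduced_rs Phi.
Hypothesis irrP : irreducible_rs cor Phi.
Hypothesis QP : W_invariant_scalar_product cor Phi Q.
Hypothesis minP : min_sp_one Phi Q.
Hypothesis baseP : simple_basis Phi Delta.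
Hypothesis htP : highest_root Phi Delta ht.

Local Notation "'[ x , y ]" := (sp Q x y).
Local Notation refl := (refl_mx cor).
Local Notation W := (in_W cor Phi).
Local Notation al := (tnth Delta).
Local Notation pos := (posb Delta).
Local Notation rmax := (rmax Phi Q).
Local Notation long := (longb Phi Q).

Implicit Types (w u v : 'M[R]_n) (x y z a b g : V).

(** * The scalar product and the action of the Weyl group *)

Lemma spDl x y z : '[x + y, z] = '[x, z] + '[y, z].
Proof. by rewrite /sp !mulmxDl mxE. Qed.

Lemma spDr x y z : '[x, y + z] = '[x, y] + '[x, z].
Proof. by rewrite /sp linearD mulmxDr mxE. Qed.

Lemma spZl c x y : '[c *: x, y] = c * '[x, y].
Proof. by rewrite /sp -!scalemxAl mxE. Qed.

Lemma spZr c x y : '[x, c *: y] = c * '[x, y].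
Proof. by rewrite /sp linearZ -scalemxAr mxE. Qed.

Lemma spNl x y : '[- x, y] = - '[x, y].
Proof. by rewrite -scaleN1r spZl mulN1r. Qed.

Lemma spNr x y : '[x, - y] = - '[x, y].
Proof. by rewrite -scaleN1r spZr mulN1r. Qed.

Lemma spBl x y z : '[x - y, z] = '[x, z] - '[y, z].
Proof. by rewrite spDl spNl. Qed.

Lemma spBr x y z : '[x, y - z] = '[x, y] - '[x, z].
Proof. by rewrite spDr spNr. Qed.

Lemma sp0r x : '[x, 0] = 0.
Proof. by rewrite -(scale0r 0) spZr mul0r. Qed.

Definition spE := (spBl, spBr, spDl, spDr, spNl, spNr, spZl, spZr).

Lemma sp_sumr x m (F : 'I_m -> V) : '[x, \sum_i F i] = \sum_i '[x, F i].
Proof. by apply: (big_morph (sp Q x)) => [y z|]; rewrite ?spDr ?sp0r. Qed.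

Lemma spC x y : '[x, y] = '[y, x].
Proof.
case: QP => QT _ _.
by rewrite /sp -[in LHS](trmxK (x *m Q *m y^T)) mxE !trmx_mul trmxK QT mulmxA.
Qed.

Lemma sp_pos x : x != 0 -> 0 < '[x, x].
Proof. by case: QP => _ + _; apply. Qed.

Lemma root_neq0 a : a \in Phi -> a != 0.
Proof. by move=> aP; apply: contraTneq aP => ->; case: rsP. Qed.

Lemma sp_root a : a \in Phi -> 0 < '[a, a].
Proof. by move/root_neq0/sp_pos. Qed.

Lemma actD w x y : act w (x + y) = act w x + act w y.
Proof. exact: mulmxDl. Qed.

Lemma actZ w c x : act w (c *: x) = c *: act w x.
Proof. by rewrite /act scalemxAl. Qed.

Lemma actN w x : act w (- x) = - act w x.
Proof. by rewrite /act mulNmx. Qed.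

Lemma actB w x y : act w (x - y) = act w x - act w y.
Proof. by rewrite actD actN. Qed.

Lemma act1 x : act (1%:M : 'M[R]_n) x = x.
Proof. exact: mulmx1. Qed.

(** Matrices act on row vectors from the right, so in a product the left factor is applied first:
    [u *m refl g] is the operator s_g u. *)
Lemma actM w w' x : act (w *m w') x = act w' (act w x).
Proof. exact: mulmxA. Qed.

Lemma act_ext (w w' : 'M[R]_n) : (forall x, act w x = act w' x) -> w = w'.
Proof. by move=> e; apply/row_matrixP => i; rewrite !rowE; apply: e. Qed.

Lemma W_refl a : a \in Phi -> W (refl a).
Proof. by move=> aP; rewrite -(mul1mx (refl a)); apply: W_step => //; apply: W_one. Qed.

Lemma W_sp w x y : W w -> '[act w x, act w y] = '[x, y].
Proof. by case: QP => _ _ +; apply. Qed.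

(** Invariance under s_a, applied to the pair (x, a) with s_a a = -a, determines the coroot from the
    scalar product. *)
Lemma cpairE a x : a \in Phi -> cpair cor x a = 2 * '[x, a] / '[a, a].
Proof.
move=> aP; have := W_sp x a (W_refl aP); rewrite !act_refl_mx.
case: rsP => _ _ -> // _ _; rewrite !spE => e.
apply: (mulIf (lt0r_neq0 (sp_root aP))); rewrite divfK ?lt0r_neq0 ?sp_root //.
lra.
Qed.

Lemma reflE a x : a \in Phi -> act (refl a) x = x - (2 * '[x, a] / '[a, a]) *: a.
Proof. by move=> aP; rewrite act_refl_mx cpairE. Qed.

Lemma reflK a x : a \in Phi -> act (refl a) (act (refl a) x) = x.
Proof.
move=> aP; rewrite !(reflE _ aP) !spE.
have := lt0r_neq0 (sp_root aP); move: '[a, a] '[x, a] => p q p0.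
rewrite -addrA -opprD -scalerDl [X in X *: _](_ : _ = 0) ?scale0r ?subr0 //.
by field.
Qed.


Lemma sp_refl a x : a \in Phi -> '[act (refl a) x, a] = - '[x, a].
Proof.
move=> aP; rewrite reflE // !spE divfK ?lt0r_neq0 ?sp_root //.
by ring.
Qed.

Lemma refl_root a : a \in Phi -> act (refl a) a = - a.
Proof.
move=> aP; rewrite act_refl_mx; case: rsP => _ _ -> // _ _.
by rewrite scaler_nat mulr2n opprD addNKr.
Qed.

Lemma refl_Phi a b : a \in Phi -> b \in Phi -> act (refl a) b \in Phi.
Proof. by case: rsP => _ _ _ + _; apply. Qed.

Lemma Phi_opp a : a \in Phi -> - a \in Phi.
Proof. by move=> aP; rewrite -refl_root ?refl_Phi. Qed.

Lemma W_Phi w a : W w -> a \in Phi -> act w a \in Phi.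
Proof.
move=> wW; elim: w / wW a => [|w b _ IH bP] a aP; first by rewrite act1.
by rewrite actM refl_Phi ?IH.
Qed.

Lemma W_mul w w' : W w -> W w' -> W (w *m w').
Proof.
move=> wW; elim=> [|u a _ IH aP]; first by rewrite mulmx1.
by rewrite mulmxA; apply: W_step.
Qed.

Lemma refl_invol a : a \in Phi -> refl a *m refl a = 1%:M.
Proof. by move=> aP; apply: act_ext => x; rewrite actM reflK ?act1. Qed.

Lemma W_inv w : W w -> exists w', [/\ W w', w *m w' = 1%:M & w' *m w = 1%:M].
Proof.
elim=> [|u a _ [u' [uW e1 e2]] aP].
  by exists 1%:M; rewrite !mulmx1; split=> //; apply: W_one.
exists (refl a *m u'); split; first by apply: W_mul => //; apply: W_refl.
  by rewrite mulmxA -(mulmxA u) refl_invol // mulmx1.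
by rewrite mulmxA -(mulmxA (refl a)) e2 mulmx1 refl_invol.
Qed.

Lemma W_surj w a : W w -> a \in Phi -> exists2 b, b \in Phi & act w b = a.
Proof.
move=> /W_inv[w' [w'W _ e]] aP; exists (act w' a); first exact: W_Phi.
by rewrite -actM e act1.
Qed.

Lemma refl_conj w a : W w -> a \in Phi -> w *m refl (act w a) = refl a *m w.
Proof.
move=> wW aP; apply: act_ext => x.
by rewrite !actM !reflE ?W_Phi // !W_sp // actB actZ.
Qed.

Lemma refl_opp a : a \in Phi -> refl (- a) = refl a.
Proof.
move=> aP; apply: act_ext => x; rewrite !reflE ?Phi_opp // !spE opprK.
by rewrite scalerN !mulrN !mulNr scaleNr opprK.
Qed.

(** * Cartan integers *)

Lemma cpair_int a b : a \in Phi -> b \in Phi ->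
  exists k : int, 2 * '[b, a] / '[a, a] = k%:~R.
Proof. by case: rsP => _ _ _ _ H aP bP; rewrite -cpairE //; apply: H. Qed.

(** Equality would make [a] and [b] proportional, hence equal up to sign in a reduced system. *)
Lemma cauchy_schwarz_root a b : a \in Phi -> b \in Phi -> a != b -> a != - b ->
  '[a, b] ^+ 2 < '[a, a] * '[b, b].
Proof.
move=> aP bP ab aNb; have b0 := sp_root bP.
have : 0 < '['[b, b] *: a - '[a, b] *: b, '[b, b] *: a - '[a, b] *: b].
  apply: sp_pos; rewrite subr_eq0; apply/eqP => e.
  have ea : a = ('[a, b] / '[b, b]) *: b.
    by rewrite mulrC -scalerA -e scalerA mulVf ?scale1r // lt0r_neq0.
  have := redP (c := '[a, b] / '[b, b]) bP; rewrite -ea => /(_ aP).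
  case=> e1; move: ea; rewrite e1 ?scaleN1r ?scale1r => ea.
    by rewrite ea eqxx in ab.
  by rewrite ea eqxx in aNb.
rewrite !spE (spC b a) => H; suff : 0 < '[b, b] * ('[a, a] * '[b, b] - '[a, b] ^+ 2).
  by rewrite pmulr_rgt0 // subr_gt0.
by congr (0 < _): H; ring.
Qed.

(* The product of the two Cartan integers is a positive integer less than 4, so the
   smaller one is 1. *)
Lemma cartan_integers a b : a \in Phi -> b \in Phi -> a != b -> a != - b ->
  0 < '[a, b] -> '[b, b] <= '[a, a] ->
  2 * '[a, b] = '[a, a] /\
  exists2 k : nat, (0 < k <= 3)%N & '[a, a] = k%:R * '[b, b].
Proof.
move=> aP bP ab aNb sab le_ba.
have [a0 b0] := (sp_root aP, sp_root bP).
have [p ep] := cpair_int bP aP; have [q eq] := cpair_int aP bP.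
have cs := cauchy_schwarz_root aP bP ab aNb.
have ep' : 2 * '[a, b] = p%:~R * '[b, b] by rewrite -ep divfK // lt0r_neq0.
have eq' : 2 * '[a, b] = q%:~R * '[a, a].
  by rewrite -eq spC divfK // lt0r_neq0.
have p0 : 0 < p by rewrite -(ltr0z R) -(pmulr_lgt0 _ b0) -ep' mulr_gt0.
have q0 : 0 < q by rewrite -(ltr0z R) -(pmulr_lgt0 _ a0) -eq' mulr_gt0.
have le_qp : q <= p.
  rewrite -(ler_int R) leNgt; apply/negP => lt_pq.
  suff : p%:~R * '[b, b] < q%:~R * '[a, a] by rewrite -ep' -eq' ltxx.
  apply: lt_le_trans (_ : q%:~R * '[b, b] <= _); first by rewrite ltr_pM2r.
  by rewrite ler_pM2l // ltr0z.
have pq4 : p * q < 4.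
  rewrite -(ltr_int R) intrM -(ltr_pM2r (mulr_gt0 a0 b0)).
  have -> : p%:~R * q%:~R * ('[a, a] * '[b, b])
     = (p%:~R * '[b, b]) * (q%:~R * '[a, a]) by ring.
  rewrite -ep' -eq'; have -> : 2 * '[a, b] * (2 * '[a, b]) = 4 * '[a, b] ^+ 2 by ring.
  by rewrite ltr_pM2l.
have q1 : q = 1 by nia.
move: eq' ep'; rewrite q1 mul1r => e1 e2; split=> //.
case: p p0 le_qp pq4 e2 {ep} => // k k0 _ k4 e2; exists k; last by rewrite -e1 e2.
by rewrite q1 mulr1 in k4; lia.
Qed.

(** * Root lengths *)

Lemma rmax_spec : (forall a, a \in Phi -> '[a, a] <= rmax) /\
  (exists2 a, a \in Phi & '[a, a] = rmax).
Proof.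
have [_ [a0 a0P e0]] := minP.
(* The maximum over a list has default value 0, so the induction carries the case [rmax = 0]; the
   root of squared length 1 excludes it. *)
suff [ub at_max] : (forall a, a \in Phi -> '[a, a] <= rmax) /\
    (rmax = 0 \/ exists2 a, a \in Phi & '[a, a] = rmax).
  split=> //; case: at_max => // r0; have := ub _ a0P.
  by rewrite r0 e0 ler10.
rewrite /Defs.rmax; elim: Phi => [|b s [IH1 IH2]].
  by split=> //; left; rewrite big_nil.
rewrite big_cons; split=> [a|].
  by rewrite inE le_max => /predU1P[->|/IH1->]; rewrite ?lexx ?orbT.
case: (leP '[b, b]) => _; last by right; exists b; rewrite ?mem_head.
by case: IH2 => [->|[a aP <-]]; [left|right; exists a; rewrite // inE aP orbT].
Qed.

Lemma le_rmax a : a \in Phi -> '[a, a] <= rmax.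
Proof. by case: rmax_spec => + _; apply. Qed.

Lemma longP a : reflect (a \in Phi /\ '[a, a] = rmax) (long a).
Proof. by apply: (iffP andP) => -[aP] /eqP. Qed.

Lemma long_Phi a : long a -> a \in Phi.
Proof. by case/longP. Qed.

Lemma long_sp a : long a -> '[a, a] = rmax.
Proof. by case/longP. Qed.

Lemma rmax_gt0 : 0 < rmax.
Proof. by have [_ [a aP <-]] := rmax_spec; apply: sp_root. Qed.

Lemma W_long w a : W w -> long a -> long (act w a).
Proof. by move=> wW /longP[aP e]; apply/longP; rewrite W_Phi // W_sp. Qed.

Lemma long_opp a : long a -> long (- a).
Proof. by case/longP => aP e; apply/longP; rewrite Phi_opp // !spE opprK. Qed.

Lemma long_refl a b : a \in Phi -> long b -> long (act (refl a) b).
Proof. by move=> aP; apply/W_long/W_refl. Qed.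

(* Irreducibility enters only here: the roots meeting some root of a given length form
   a union of components. *)
Lemma root_of_length_meeting a b : a \in Phi -> b \in Phi ->
  exists c, [/\ c \in Phi, '[c, c] = '[a, a] & 0 < '[c, b]].
Proof.
move=> aP bP.
pose P b := has (fun c => ('[c, c] == '[a, a]) && ('[c, b] != 0)) Phi.
suff /hasP[c cP /andP[/eqP ec cb]] : P b.
  case: (ltgtP '[c, b] 0) cb => // cb _; last by exists c.
  by exists (- c); rewrite Phi_opp // !spE !opprK oppr_gt0.
apply/negPn/negP => nPb; case: irrP; exists P; split; last first.
- move=> x y xP yP /hasP[c cP /andP[/eqP ec cx]] /hasPn nPy.
  have ort d : d \in Phi -> '[d, d] = '[a, a] -> '[d, y] = 0.
    by move=> dP ed; have := nPy d dP; rewrite ed eqxx /= => /negPn/eqP.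
  have xy : '[x, y] = 0.
    have := ort (act (refl x) c); rewrite refl_Phi // W_sp ?ec; last exact: W_refl.
    move=> /(_ isT erefl); rewrite reflE // !spE (ort c) // sub0r => /eqP.
    rewrite oppr_eq0 !mulf_eq0 invr_eq0 (negPf cx) (gt_eqF (sp_root xP)).
    by rewrite pnatr_eq0 /= => /eqP.
  by rewrite !cpairE // (spC y) xy mulr0 !mul0r.
- by exists b.
by exists a => //; apply/hasP; exists a => //; rewrite eqxx gt_eqF // sp_root.
Qed.

(** By irreducibility some root of the same length as [a] is not orthogonal to [b]; its Cartan
    integers with [b] give the ratio. *)
Lemma length_ratio a b : a \in Phi -> b \in Phi -> '[b, b] < '[a, a] ->
  exists2 k : nat, (1 < k <= 3)%N & '[a, a] = k%:R * '[b, b].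
Proof.
move=> aP bP lt_ba; have [c [cP ec cb]] := root_of_length_meeting aP bP.
have cNb : c != b by apply: contraTneq lt_ba => e; rewrite -ec e ltxx.
have cNNb : c != - b by apply: contraTneq lt_ba => e; rewrite -ec e !spE opprK ltxx.
have [|_ [k k3 ek]] := cartan_integers cP bP cNb cNNb cb; first by rewrite ec ltW.
exists k; last by rewrite -ec.
case: k k3 ek => [|[|k]] // _; rewrite mul1r ec => e; by rewrite e ltxx in lt_ba.
Qed.

(** A third length would give three ratios in {2, 3}, one of them the product of the other two and
    so at least 4. *)
Lemma short_length a : a \in Phi -> ~~ long a -> '[a, a] = 1.
Proof.
have [_ [M MP eM]] := rmax_spec; have [ge1 [m mP em]] := minP.
move=> aP; rewrite /longb aP /= => aM.
have lt_aM : '[a, a] < '[M, M] by rewrite eM lt_neqAle aM le_rmax.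
have := ge1 a aP; rewrite le_eqVlt => /predU1P[<-//|]; rewrite -em => lt_ma.
have [k1 k1P e1] := length_ratio MP aP lt_aM.
have [k2 k2P e2] := length_ratio aP mP lt_ma.
have [k3 k3P e3] := length_ratio MP mP (lt_trans lt_ma lt_aM).
move: e3; rewrite e1 e2 em !mulr1 -natrM => /eqP; rewrite eqr_nat => /eqP e.
by exfalso; nia.
Qed.

(** * Positive roots *)

Lemma base_free : free Delta.
Proof. by case: baseP. Qed.

Lemma al_Phi i : al i \in Phi.
Proof. by case: baseP. Qed.

Lemma coordE x : x = \sum_i coord Delta i x *: al i.
Proof.
have bas : basis_of fullv Delta.
  by rewrite basisEfree base_free subvf dimvf /dim /= size_tuple mul1n.
rewrite {1}(coord_basis bas (memvf x)); apply: eq_bigr => i _.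
by rewrite (tnth_nth 0).
Qed.

Lemma coord_al i j : coord Delta j (al i) = (i == j)%:R.
Proof. by rewrite (tnth_nth 0) coord_free // base_free. Qed.

Lemma coord_inj x y : (forall i, coord Delta i x = coord Delta i y) -> x = y.
Proof.
by move=> e; rewrite (coordE x) (coordE y); apply: eq_bigr => i _; rewrite e.
Qed.

Lemma sp_coord x y : '[x, y] = \sum_i coord Delta i y * '[x, al i].
Proof. by rewrite {1}(coordE y) sp_sumr; apply: eq_bigr => i _; rewrite spZr. Qed.

Lemma pos_coord a i : pos a -> 0 <= coord Delta i a.
Proof. by move/forallP. Qed.

Lemma coord_root a : a \in Phi -> forall i, exists k : int, coord Delta i a = k%:~R.
Proof.
case: baseP => _ _ H aP i; case: (H a aP) => /(_ i)[k ->].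
  by exists k%:Z.
by exists (- k%:Z); rewrite rmorphN.
Qed.

Lemma pos_oppF a : a \in Phi -> pos a -> pos (- a) = false.
Proof.
move=> aP pa; apply/negP => na; case/negP: (root_neq0 aP).
apply/eqP/coord_inj => i.
apply/eqP; rewrite linear0 eq_le pos_coord // andbT -oppr_ge0 -linearN.
exact: pos_coord.
Qed.

Lemma posN a : a \in Phi -> pos (- a) = ~~ pos a.
Proof.
move=> aP; case: (boolP (pos a)) => [/(pos_oppF aP)//|npa].
case: baseP => _ _ /(_ a aP)[] H; last first.
  by apply/forallP => i; have [k e] := H i; rewrite linearN /= e opprK ler0n.
by case/negP: npa; apply/forallP => i; have [k ->] := H i; rewrite ler0n.
Qed.

Lemma pos_of_coord a i : a \in Phi -> 0 < coord Delta i a -> pos a.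
Proof.
move=> aP a_i; apply: contraLR a_i; rewrite -posN // => /(pos_coord i).
by rewrite linearN oppr_ge0 leNgt.
Qed.

Lemma al_pos i : pos (al i).
Proof. by apply/forallP => j; rewrite coord_al ler0n. Qed.

Lemma coord_refl_al i j a : coord Delta j (act (refl (al i)) a) =
  coord Delta j a - 2 * '[a, al i] / '[al i, al i] * (i == j)%:R.
Proof. by rewrite reflE ?al_Phi // linearB linearZ /= coord_al. Qed.

(** s_i changes only the i-th coordinate, and a positive root other than alpha_i has another
    positive coordinate because the system is reduced. *)
Lemma pos_refl_al i a : a \in Phi -> pos a -> a != al i -> pos (act (refl (al i)) a).
Proof.
move=> aP pa ai; case: (pickP (fun j => (j != i) && (0 < coord Delta j a))).
  move=> j /andP[ji aj]; apply: (@pos_of_coord _ j); rewrite ?refl_Phi ?al_Phi //.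
  by rewrite coord_refl_al eq_sym (negPf ji) mulr0 subr0.
move=> none; have ea : a = coord Delta i a *: al i.
  apply: coord_inj => j; rewrite linearZ /= coord_al.
  case: (eqVneq i j) => [<-|ij]; first by rewrite mulr1.
  rewrite mulr0; have := none j; rewrite eq_sym ij /= lt_neqAle pos_coord //.
  by rewrite andbT => /negbT; rewrite negbK eq_sym => /eqP.
have := redP (al_Phi i); move/(_ (coord Delta i a)); rewrite -ea => /(_ aP)[] e.
  by rewrite ea e scale1r eqxx in ai.
by have := pos_coord i pa; rewrite e ler0N1.
Qed.

Lemma pos_sp_al a : a \in Phi -> pos a -> exists i, 0 < '[a, al i].
Proof.
move=> aP pa; apply/existsP; apply: contraLR (sp_root aP); rewrite negb_exists.
move=> /forallP H; rewrite -leNgt sp_coord; apply: sumr_le0 => i _.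
by apply: mulr_ge0_le0; rewrite ?pos_coord // leNgt.
Qed.

Definition height x : R := \sum_i coord Delta i x.

Lemma heightB x y : height (x - y) = height x - height y.
Proof.
by rewrite /height -sumrB; apply: eq_bigr => i _; rewrite linearB.
Qed.

Lemma height_refl_al i a : height (act (refl (al i)) a) =
  height a - 2 * '[a, al i] / '[al i, al i].
Proof.
rewrite reflE ?al_Phi // heightB; congr (_ - _).
rewrite /height (bigD1 i) //= linearZ /= coord_al eqxx mulr1.
by rewrite big1 ?addr0 // => j ji; rewrite linearZ /= coord_al eq_sym (negPf ji) mulr0.
Qed.

Lemma height_int a : a \in Phi -> exists k : int, height a = k%:~R.
Proof.
move=> aP; rewrite /height.
apply: (big_ind (fun h => exists k : int, h = k%:~R)); first by exists 0.
  by move=> _ _ [k ->] [l ->]; exists (k + l); rewrite rmorphD.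
by move=> i _; apply: coord_root aP i.
Qed.

Lemma height_pos a : pos a -> 0 <= height a.
Proof. by move=> pa; apply: sumr_ge0 => i _; apply: pos_coord. Qed.

(** Induction on the height: (a|a) > 0 forces (a|alpha_i) > 0 for some i, and then s_i lowers the
    height. *)
Lemma pos_root_ind (P : V -> Prop) :
  (forall i, P (al i)) ->
  (forall a i, a \in Phi -> pos a -> 0 < '[a, al i] -> pos (act (refl (al i)) a) ->
     P (act (refl (al i)) a) -> P a) ->
  forall a, a \in Phi -> pos a -> P a.
Proof.
move=> P1 PS a aP pa; have [[m|m] hm] := height_int aP; last first.
  by have := height_pos pa; rewrite hm ler0z.
elim/ltn_ind: m a aP pa hm => m IH a aP pa hm.
have [i ai] := pos_sp_al aP pa.
case: (eqVneq a (al i)) => [->//|nai].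
have sP := refl_Phi (al_Phi i) aP; have sp := pos_refl_al aP pa nai.
apply: (PS a i) => //; have [[k|k] hk] := height_int sP; last first.
  by have := height_pos sp; rewrite hk ler0z.
apply: (IH k) => //; rewrite -(ltr_nat R) [k%:R](esym hk) [m%:R](esym hm).
by rewrite height_refl_al gtrBl divr_gt0 ?mulr_gt0 // sp_root ?al_Phi.
Qed.

(** * Words and the exchange condition *)

(** The list i1, ..., ik stands for the operator s_i1 ... s_ik; its head is applied last. *)
Definition word (s : seq 'I_n) : 'M[R]_n :=
  foldr (fun i M => M *m refl (al i)) 1%:M s.

Lemma word_rcons s i : word (rcons s i) = refl (al i) *m word s.
Proof.
elim: s => [|j s IH] /=; first by rewrite mul1mx mulmx1.
by rewrite IH mulmxA.
Qed.

Lemma word_W s : W (word s).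
Proof. by elim: s => [|i s IH] /=; [apply: W_one|apply/W_step/al_Phi]. Qed.

(** Since s_a = s_i s_b s_i with b = s_i a, lowering [a] writes every reflection as a product of
    simple ones. The word [s] stays general so that the hypothesis applies to [i :: s]. *)
Lemma word_mul_refl a s : a \in Phi -> pos a -> exists s', word s *m refl a = word s'.
Proof.
move=> aP pa; move: a aP pa s.
apply: pos_root_ind => [i s|a i aP _ _ _ IH s].
  by exists (i :: s).
have [s' e] := IH (i :: s); exists (i :: s').
rewrite /= -e /= -!mulmxA; congr (_ *m _).
have iP := al_Phi i; rewrite mulmxA (refl_conj (W_refl iP) aP) -mulmxA.
by rewrite refl_invol ?mulmx1.
Qed.

Lemma W_wordP w : W w -> exists s, w = word s.
Proof.
elim=> [|u a _ [s ->] aP]; first by exists [::].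
case: (boolP (pos a)) => pa.
  by have [s' e] := word_mul_refl s aP pa; exists s'.
have [|s' e] := word_mul_refl s (Phi_opp aP); first by rewrite posN.
by exists s'; rewrite -e refl_opp.
Qed.

(** Peel off the letter i applied last. If g = alpha_i, then s_g cancels it; otherwise s_i g is
    still positive and the induction deletes a letter further on. *)
Lemma exchange s b g : b \in Phi -> pos b -> g \in Phi -> pos g ->
  act (word s) b = - g -> exists2 s', (size s' < size s)%N & word s *m refl g = word s'.
Proof.
move=> bP pb; elim: s g => [|i s IH] g gP pg /=.
  by rewrite act1 => e; rewrite e posN // pg in pb.
have iP := al_Phi i; rewrite actM => e.
case: (eqVneq g (al i)) => [->|gi].
  by exists s => //; rewrite -mulmxA refl_invol ?mulmx1.
have [|||s' lt_s' e'] := IH (act (refl (al i)) g).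
- exact: refl_Phi.
- exact: pos_refl_al.
- by rewrite -actN -e reflK.
exists (i :: s') => //=; rewrite -e' -!mulmxA; congr (_ *m _).
by rewrite -(refl_conj (W_refl iP)) ?reflK ?refl_Phi.
Qed.

Local Notation simple_word := (simple_word cor Delta).
Local Notation is_length := (is_length cor Delta).

(** There are finitely many words of each size, so the property is decidable and a least size can be
    chosen. *)
Lemma simple_wordP k w :
  reflect (simple_word k w) [exists s : k.-tuple 'I_n, w == word s].
Proof.
apply: (iffP existsP) => [[s /eqP ->]|[s [sz ->]]].
  by exists s; rewrite size_tuple.
by exists (tcast sz (in_tuple s)); rewrite val_tcast.
Qed.

Lemma is_length_ex w : W w -> exists k, is_length w k.
Proof.
move=> /W_wordP[s e].
have ex : exists k, [exists s : k.-tuple 'I_n, w == word s].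
  by exists (size s); apply/simple_wordP; exists s.
case: (ex_minnP ex) => k /simple_wordP wk min; exists k; split=> // j jk /simple_wordP.
by move=> /min; rewrite leqNgt jk.
Qed.

Lemma is_length_min w k j : is_length w k -> simple_word j w -> (k <= j)%N.
Proof. by case=> _ min wj; rewrite leqNgt; apply/negP => /min. Qed.

Lemma is_length_uniq w j k : is_length w j -> is_length w k -> j = k.
Proof.
move=> wj wk; apply/eqP; rewrite eqn_leq (is_length_min wj) ?(is_length_min wk) //.
- by case: wj.
- by case: wk.
Qed.

Lemma is_length_W w k : is_length w k -> W w.
Proof. by case=> -[s [_ ->]] _; apply: word_W. Qed.

Lemma simple_word_mul i k w : simple_word k w -> simple_word k.+1 (w *m refl (al i)).
Proof. by case=> s [<- ->]; exists (i :: s). Qed.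

Lemma simple_word_lmul i k w : simple_word k w -> simple_word k.+1 (refl (al i) *m w).
Proof.
by case=> s [<- ->]; exists (rcons s i); rewrite size_rcons -word_rcons.
Qed.

Lemma is_length_exchange w k b g : is_length w k -> b \in Phi -> pos b ->
  g \in Phi -> pos g -> act w b = - g ->
  exists2 j, (j < k)%N & is_length (w *m refl g) j.
Proof.
move=> wk bP pb gP pg e; have [[s [sz ew]] _] := wk; move: e; rewrite ew => e.
have [s' lt_s' e'] := exchange bP pb gP pg e.
have [|j wj] := @is_length_ex (w *m refl g).
  by apply: W_step => //; apply: is_length_W wk.
exists j; last by move: wj; rewrite ew.
apply: leq_ltn_trans (is_length_min wj _) _; last by rewrite -sz; apply: lt_s'.
by exists s'; rewrite ew.
Qed.

(** Exchange shortens by at least one, and restoring the letter costs at most one. *)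
Lemma is_length_down w k b i : is_length w k -> b \in Phi -> pos b ->
  act w b = - al i -> exists2 j, k = j.+1 & is_length (w *m refl (al i)) j.
Proof.
move=> wk bP pb e; have iP := al_Phi i.
have [j jk wj] := is_length_exchange wk bP pb iP (al_pos i) e.
exists j => //; apply/eqP; rewrite eqn_leq jk andbT (is_length_min wk) //.
rewrite -[w]mulmx1 -(refl_invol iP) mulmxA; apply: simple_word_mul.
by case: wj.
Qed.

Lemma is_length_up w k b i : is_length w k -> b \in Phi -> pos b ->
  act w b = al i -> is_length (w *m refl (al i)) k.+1.
Proof.
move=> wk bP pb e; have iP := al_Phi i.
have [|m wm] := @is_length_ex (w *m refl (al i)).
  by apply: W_step => //; apply: is_length_W wk.
have [|j ej] := is_length_down wm bP pb (i := i).
  by rewrite actM e refl_root.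
rewrite -mulmxA refl_invol // mulmx1 => /(is_length_uniq wk) ->.
by rewrite -ej.
Qed.

(** Since w s_i = s_h w, a letter on the other side is again removed by exchange. *)
Lemma is_length_rdown w k i h : is_length w k -> h \in Phi -> pos h ->
  act w (al i) = - h -> exists2 j, k = j.+1 & is_length (refl (al i) *m w) j.
Proof.
move=> wk hP ph e; have iP := al_Phi i.
have [j jk] := is_length_exchange wk iP (al_pos i) hP ph e.
have -> : w *m refl h = refl (al i) *m w.
  by rewrite -(refl_conj (is_length_W wk) iP) e refl_opp.
move=> wj; exists j => //; apply/eqP; rewrite eqn_leq jk andbT (is_length_min wk) //.
rewrite -[w]mul1mx -(refl_invol iP) -mulmxA; apply: simple_word_lmul.
by case: wj.
Qed.

Lemma is_length_rup w k i : is_length w k -> pos (act w (al i)) ->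
  is_length (refl (al i) *m w) k.+1.
Proof.
move=> wk pw; have iP := al_Phi i; have wW := is_length_W wk.
have [|m wm] := @is_length_ex (refl (al i) *m w).
  by apply: W_mul => //; apply: W_refl.
have [||j ej] := is_length_rdown wm (h := act w (al i)) (i := i) _ pw.
- exact: W_Phi.
- by rewrite actM refl_root // actN.
rewrite mulmxA refl_invol // mul1mx => /(is_length_uniq wk) ->.
by rewrite -ej.
Qed.

Lemma is_length0 w : is_length w 0 -> w = 1%:M.
Proof. by case=> -[[|i s] [//= _ ->]]. Qed.

(** Split off the letter applied last. The root [b] that [u] sends to alpha_i is positive, since
    otherwise this letter would shorten [u]. *)
Lemma is_lengthS w k : is_length w k.+1 -> exists i u b,
  [/\ is_length u k, w = u *m refl (al i), b \in Phi, pos b & act u b = al i].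
Proof.
move=> wk; have [[[|i s] [//= [sz] ew]] _] := wk; have iP := al_Phi i.
exists i, (word s); have [b bP e] := W_surj (word_W s) iP.
have [m um] := is_length_ex (word_W s).
have mk : (m <= k)%N by apply: (is_length_min um); exists s.
case: (boolP (pos b)) => pb; last first.
  have [|||j mj] := is_length_down um (b := - b) (i := i).
  - exact: Phi_opp.
  - by rewrite posN.
  - by rewrite actN e.
  by rewrite -ew => /(is_length_uniq wk) kj; exfalso; lia.
exists b; split=> //; have := is_length_up um bP pb e; rewrite -ew.
by move=> /(is_length_uniq wk)[->].
Qed.

Lemma pos_stable_id w : W w ->
  (forall b, b \in Phi -> pos b -> pos (act w b)) -> w = 1%:M.
Proof.
move=> wW H; have [[|k] wk] := is_length_ex wW; first exact: is_length0.
have [i [u [b [_ ew bP pb e]]]] := is_lengthS wk.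
have := H b bP pb; rewrite ew actM e refl_root ?al_Phi //.
by rewrite posN ?al_Phi // al_pos.
Qed.

(** * Minimal representatives and levels *)

Lemma ht_Phi : ht \in Phi.
Proof. by case: htP. Qed.

(** Otherwise s_i would increase the i-th coordinate of the highest root. *)
Lemma ht_dominant_al i : 0 <= '[ht, al i].
Proof.
case: htP => _ /(_ _ (refl_Phi (al_Phi i) ht_Phi) i).
rewrite coord_refl_al eqxx mulr1 gerBl pmulr_lge0 ?invr_gt0 ?sp_root ?al_Phi //.
by rewrite pmulr_rge0.
Qed.

Lemma ht_dominant a : pos a -> 0 <= '[ht, a].
Proof.
move=> pa; rewrite sp_coord; apply: sumr_ge0 => i _.
by rewrite mulr_ge0 ?pos_coord // ht_dominant_al.
Qed.

Lemma pos_of_ht a : a \in Phi -> 0 < '[ht, a] -> pos a.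
Proof.
move=> aP; apply: contraLR; rewrite -posN // => /ht_dominant.
by rewrite spNr oppr_ge0 leNgt.
Qed.

(** (ht|a) is a sum of nonnegative terms, so it vanishes only if every simple root occurring in [a]
    is orthogonal to [ht]. This turns the span condition in [XI] into orthogonality. *)
Lemma ht_orth_span a : pos a -> ('[ht, a] == 0) = (a \in <<Itilde Q Delta ht>>%VS).
Proof.
move=> pa; apply/eqP/idP => [e|].
  rewrite (coordE a); apply: memv_suml => i _.
  have := @psumr_eq0P _ _ _ (fun i => coord Delta i a * '[ht, al i]) _ _ i isT.
  rewrite -sp_coord e => H; have {H} /eqP : coord Delta i a * '[ht, al i] = 0.
    by apply: H => // j _; rewrite mulr_ge0 ?pos_coord ?ht_dominant_al.
  rewrite mulf_eq0 => /orP[/eqP ->|hi]; first by rewrite scale0r mem0v.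
  by apply/memvZ/memv_span; rewrite mem_filter hi mem_tnth.
move=> aI; rewrite (coord_span (X := in_tuple (Itilde Q Delta ht)) aI) sp_sumr.
apply: big1 => i _; rewrite spZr [X in _ * X](_ : _ = 0) ?mulr0 //.
have := mem_nth 0 (ltn_ord i); rewrite mem_filter => /andP[/eqP].
by [].
Qed.

Lemma XIP w : XI cor Phi Q Delta ht w <->
  W w /\ forall a, a \in Phi -> pos a -> '[ht, a] = 0 -> pos (act w a).
Proof.
split=> -[wW H]; split=> // a.
  move=> aP pa e; suff /H/andP[] : pos_root_I Phi Q Delta ht a by [].
  by split=> //; rewrite -ht_orth_span // e.
move=> [aP pa]; rewrite -ht_orth_span // => /eqP e.
by rewrite W_Phi //= H.
Qed.

(** * Coroot heights and levels *)

Local Notation htv := (htv Phi Q Delta).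
Local Notation L := (level Phi Q Delta ht).
Local Notation X := (XI cor Phi Q Delta ht).

(* [htv] is the height of the coroot, up to scaling, which makes it independent of the
   long/short dichotomy of the simple roots. *)
Lemma htvE x : htv x = \sum_i coord Delta i x * ('[al i, al i] / rmax).
Proof.
rewrite /Defs.htv mulr_sumr big_mkcond [X in _ + X]big_mkcond -big_split /=.
apply: eq_bigr => i _; case: (boolP (long (al i))) => [li|nli] /=.
  by rewrite addr0 (long_sp li) divff ?mulr1 // gt_eqF // rmax_gt0.
by rewrite add0r (short_length (al_Phi i) nli) mul1r mulrC.
Qed.

Lemma htvB x y : htv (x - y) = htv x - htv y.
Proof.
rewrite !htvE -sumrB; by apply: eq_bigr => i _; rewrite linearB mulrBl.
Qed.

Lemma htvZ c x : htv (c *: x) = c * htv x.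
Proof.
rewrite !htvE mulr_sumr; by apply: eq_bigr => i _; rewrite linearZ /= -mulrA.
Qed.

Lemma htvN x : htv (- x) = - htv x.
Proof. by rewrite -scaleN1r htvZ mulN1r. Qed.

Lemma htv_al i : htv (al i) = '[al i, al i] / rmax.
Proof.
rewrite htvE (bigD1 i) //= coord_al eqxx mul1r big1 ?addr0 // => j ji.
by rewrite coord_al eq_sym (negPf ji) mul0r.
Qed.

Lemma htv_gt0 a : a \in Phi -> pos a -> 0 < htv a.
Proof.
move=> aP pa; have ge0 i : 0 <= coord Delta i a * ('[al i, al i] / rmax).
  by rewrite mulr_ge0 ?pos_coord // divr_ge0 // ltW ?rmax_gt0 ?sp_root ?al_Phi.
rewrite lt_neqAle htvE sumr_ge0 // andbT eq_sym.
apply/eqP => sum0; have e0 := psumr_eq0P (fun i _ => ge0 i) sum0.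
case/negP: (root_neq0 aP); apply/eqP/coord_inj => i; rewrite linear0.
have /eqP := e0 i isT; rewrite mulf_eq0 => /orP[/eqP//|].
by rewrite gt_eqF // divr_gt0 ?rmax_gt0 ?sp_root ?al_Phi.
Qed.

Lemma htv_refl a g : g \in Phi ->
  htv (act (refl g) a) = htv a - 2 * '[a, g] / '[g, g] * htv g.
Proof. by move=> gP; rewrite reflE // htvB htvZ. Qed.

Lemma htv_refl_al a i :
  htv (act (refl (al i)) a) = htv a - 2 * '[a, al i] / rmax.
Proof.
rewrite htv_refl ?al_Phi // htv_al mulrA divfK //.
by rewrite gt_eqF // sp_root ?al_Phi.
Qed.

Lemma long_pairing a g : long a -> g \in Phi -> a != g -> a != - g -> 0 < '[a, g] ->
  2 * '[a, g] = rmax.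
Proof.
move=> la gP ag aNg ag0; rewrite -(long_sp la).
by case: (cartan_integers (long_Phi la) gP) => //; rewrite (long_sp la) le_rmax.
Qed.

Lemma htv_refl_al_long a i : long a -> a != al i -> 0 < '[a, al i] ->
  htv (act (refl (al i)) a) = htv a - 1.
Proof.
move=> la nai ai0; rewrite htv_refl_al (long_pairing la (al_Phi i)) //.
  by rewrite divff // gt_eqF // rmax_gt0.
by apply: contraTneq ai0 => ->; rewrite spNl -leNgt oppr_le0 ltW // sp_root ?al_Phi.
Qed.

Lemma htv_al_long i : long (al i) -> htv (al i) = 1.
Proof. by move=> li; rewrite htv_al (long_sp li) divff // gt_eqF // rmax_gt0. Qed.

(** Lowering a non-simple long root by a simple reflection subtracts exactly 1 from [htv], and long
    simple roots have value 1. *)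
Lemma htv_long_pos a : long a -> pos a -> (exists i, a = al i) \/ 2 <= htv a.
Proof.
move=> la pa; have aP := long_Phi la; move: a aP pa la.
apply: pos_root_ind => [i _|a i aP pa ai _ IH la].
  by left; exists i.
case: (eqVneq a (al i)) => [->|nai]; [by left; exists i|right].
have := htv_refl_al_long la nai ai; have ls := long_refl (al_Phi i) la.
by case: (IH ls) => [[j ej]|]; [rewrite ej htv_al_long -?ej //|]; lra.
Qed.

Lemma htv_long_ge1 a : long a -> pos a -> 1 <= htv a.
Proof.
move=> la pa; case: (htv_long_pos la pa) => [[i ei]|]; last by lra.
by rewrite ei htv_al_long // -ei.
Qed.

(** The -1 in the level of negative roots compensates for the drop of 2 in [htv] from alpha_i to
    -alpha_i. *)
Lemma level_al a i : long a -> 0 < '[a, al i] -> L (act (refl (al i)) a) = L a + 1.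
Proof.
move=> la ai0; have aP := long_Phi la; have iP := al_Phi i.
case: (eqVneq a (al i)) => [ea|nai].
  rewrite /level ea refl_root // posN // al_pos /= htvN htv_al_long -?ea //; lra.
have := htv_refl_al_long la nai ai0; rewrite /level => ->.
case: (boolP (pos a)) => pa; first by rewrite pos_refl_al //; lra.
rewrite ifN; first lra.
rewrite -posN ?refl_Phi // -actN pos_refl_al ?Phi_opp ?posN //.
apply: contraTneq ai0 => e; rewrite -e spNr -leNgt oppr_le0 ltW // sp_root //.
Qed.

(** s_g lowers [htv]. If the root turns negative, the drop is at least 2 because both heights have
    absolute value at least 1, which outweighs the offset 1. *)
Lemma level_lt a g : long a -> g \in Phi -> pos g -> 0 < '[a, g] ->
  L a < L (act (refl g) a).
Proof.
move=> la gP pg ag0; have aP := long_Phi la.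
have lb := long_refl gP la; have bP := long_Phi lb.
have k0 : 0 < 2 * '[a, g] / '[g, g] by rewrite divr_gt0 ?mulr_gt0 // sp_root.
have kg := mulr_gt0 k0 (htv_gt0 gP pg); have := htv_refl a gP.
move: (2 * _ / _) k0 kg (act _ a) lb bP => k k0 kg b lb bP hb; rewrite /level.
case: (boolP (pos a)) => pa; case: (boolP (pos b)) => pb; rewrite ?hb; try lra.
  have := htv_long_ge1 la pa; rewrite -posN // in pb.
  by have := htv_long_ge1 (long_opp lb) pb; rewrite htvN; lra.
Qed.

(** * Representatives of the long roots *)

Lemma ht_pos : pos ht.
Proof.
apply/forallP => i; apply: le_trans (_ : coord Delta i (al i) <= _).
  by rewrite coord_al ler0n.
by case: htP => _; apply; apply: al_Phi.
Qed.

(** [x] sends positive roots orthogonal to [ht] to positive roots orthogonal to x(ht), hence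
    different from alpha_i, and s_i keeps those positive. *)
Lemma X_refl (x : 'M[R]_n) i : X x -> '[act x ht, al i] != 0 -> X (x *m refl (al i)).
Proof.
case/XIP => xW xpos xi; apply/XIP; split; first exact/W_step/al_Phi.
move=> a aP pa ea; rewrite actM pos_refl_al ?W_Phi //; first exact: xpos.
by apply: contraNneq xi => <-; rewrite W_sp // ea.
Qed.

Lemma X_one : X 1%:M.
Proof. by apply/XIP; split; [apply: W_one|move=> a aP pa _; rewrite act1]. Qed.

Lemma height_le_ht a : a \in Phi -> height a <= height ht.
Proof. by move=> aP; apply: ler_sum => i _; case: htP => _; apply. Qed.

Lemma dominant_long a : long a -> (forall i, 0 <= '[a, al i]) -> a = ht.
Proof.
move=> la dom; have aP := long_Phi la.
have diff_ge0 x : (forall i, 0 <= '[x, al i]) -> 0 <= '[x, ht - a].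
  move=> xdom; rewrite sp_coord; apply: sumr_ge0 => i _; apply: mulr_ge0 => //.
  by rewrite linearB subr_ge0; case: htP => _; apply.
have := diff_ge0 _ dom; have := diff_ge0 _ ht_dominant_al.
(* [ht] is not yet known to be long, but (ht|ht) <= rmax = (a|a) together with the two inequalities
   bounds the norm of ht - a by 0. *)
have := le_rmax ht_Phi; rewrite -(long_sp la) !spE (spC a ht) => h1 h2 h3.
apply/eqP; rewrite eq_sym -subr_eq0; apply: contraT => /sp_pos.
by rewrite !spE (spC a ht); lra.
Qed.

(** Induction on the height difference to [ht]: a non-dominant long root is raised by some s_i, and
    the representative found there is multiplied by s_i. *)
Lemma X_surj a : long a -> exists2 x, X x & act x ht = a.
Proof.
move=> la; have aP := long_Phi la.
have [k hk] := height_int ht_Phi; have [l hl] := height_int aP.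
have := height_le_ht aP; rewrite hk hl ler_int => lk.
have [m em] : exists m : nat, l = k - m%:Z by exists `|k - l|%N; lia.
elim/ltn_ind: m a l la aP hl lk em => m IH a l la aP hl lk em.
case: (pickP (fun i => '[a, al i] < 0)) => [i ai|dom]; last first.
  exists 1%:M; [exact: X_one|rewrite act1 (dominant_long la) // => i].
  by rewrite leNgt dom.
have iP := al_Phi i; have lb := long_refl iP la; have bP := long_Phi lb.
have [l' hl'] := height_int bP.
have ll' : l < l'.
  rewrite -(ltr_int R) -hl -hl' height_refl_al ltrBrDl gtrDr.
  by rewrite pmulr_llt0 ?invr_gt0 ?sp_root // pmulr_rlt0.
have l'k : l' <= k by have := height_le_ht bP; rewrite hk hl' ler_int.
have [||x xX ex] := IH `|k - l'|%N _ _ l' lb bP hl' l'k; try lia.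
exists (x *m refl (al i)); last by rewrite actM ex reflK.
by apply: X_refl; rewrite // ex sp_refl // oppr_eq0 lt_eqF.
Qed.

Lemma ht_long : long ht.
Proof.
have [_ [a aP ea]] := rmax_spec; have la : long a by apply/longP.
have [x /XIP[xW _] ex] := X_surj la; apply/longP; split; first exact: ht_Phi.
by rewrite -(W_sp ht ht xW) ex.
Qed.

Lemma W_ht_long w : W w -> long (act w ht).
Proof. by move=> wW; apply: W_long => //; apply: ht_long. Qed.

(** Remove the letter s_i applied last. The positive root [b] that [x] sends to -alpha_i cannot be
    orthogonal to [ht], so [u] stays in [X] and s_i raises the level by 1. *)
Lemma X_length_level (x : 'M[R]_n) k : X x -> is_length x k -> L (act x ht) = k%:R.
Proof.
elim: k x => [|k IH] x xX xk.
  by rewrite (is_length0 xk) act1 /level ht_pos subrr.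
have [i [u [b [uk ex bP pb eb]]]] := is_lengthS xk.
have uW := is_length_W uk; have iP := al_Phi i.
have hb : 0 < '[ht, b].
  rewrite lt_neqAle ht_dominant // andbT eq_sym; apply/eqP => e.
  have [_ /(_ b bP pb e)] := iffLR (XIP x) xX.
  by rewrite ex actM eb refl_root // posN // al_pos.
have uX : X u.
  have -> : u = x *m refl (al i) by rewrite ex -mulmxA refl_invol // mulmx1.
  apply: X_refl => //.
  have : '[act x ht, act x b] = '[ht, b] by rewrite W_sp //; apply: is_length_W xk.
  rewrite {2}ex actM eb refl_root // spNr => e.
  by rewrite -oppr_eq0 e gt_eqF.
have uht : 0 < '[act u ht, al i] by rewrite -eb W_sp.
by rewrite ex actM level_al ?W_ht_long // (IH u) // -natr1.
Qed.

Lemma level_nat a : long a -> exists k : nat, L a = k%:R.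
Proof.
move=> /X_surj[x xX <-]; have [k xk] := is_length_ex (proj1 (iffLR (XIP x) xX)).
by exists k; apply: X_length_level.
Qed.

(** y^-1 x fixes [ht] and keeps positive roots positive: those with (ht|b) > 0 by invariance, those
    orthogonal to [ht] because [x] and [y] are in [X]. *)
Lemma X_inj (x y : 'M[R]_n) : X x -> X y -> act x ht = act y ht -> x = y.
Proof.
case/XIP => xW xpos /XIP[yW ypos] exy.
have [y' [y'W yy' y'y]] := W_inv yW.
have uW := W_mul xW y'W; have uy : x *m y' *m y = x by rewrite -mulmxA y'y mulmx1.
have uht : act (x *m y') ht = ht by rewrite actM exy -actM yy' act1.
suff u1 : x *m y' = 1%:M by rewrite -uy u1 mul1mx.
apply: pos_stable_id => // b bP pb; have ubP := W_Phi uW bP.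
have hub : '[ht, act (x *m y') b] = '[ht, b] by rewrite -{1}uht W_sp.
have := ht_dominant pb; rewrite le_eqVlt => /predU1P[hb|hb]; last first.
  by apply: pos_of_ht; rewrite // hub.
apply: contraT; rewrite -posN // => nub.
have := ypos _ (Phi_opp ubP) nub; rewrite spNr hub -hb oppr0 => /(_ erefl).
by rewrite actN -actM uy posN ?W_Phi // xpos.
Qed.

(** * Additivity of lengths and comparison of arrows *)

Lemma is_length_rS w k : is_length w k.+1 -> exists i u,
  [/\ is_length u k, w = refl (al i) *m u & pos (act u (al i))].
Proof.
move=> wk; have [[s [sz ew]] _] := wk.
case/lastP: s sz ew => [//|s i]; rewrite size_rcons => -[sz] ew.
have {}ew : w = refl (al i) *m word s by rewrite ew [LHS]word_rcons.
have iP := al_Phi i; exists i, (word s); have [m um] := is_length_ex (word_W s).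
have mk : (m <= k)%N by apply: (is_length_min um); exists s.
case: (boolP (pos (act (word s) (al i)))) => pu.
  split=> //; have := is_length_rup um pu; rewrite -ew.
  by move=> /(is_length_uniq wk)[->].
rewrite -posN ?W_Phi //in pu; last exact: word_W.
have [||j mj] := is_length_rdown um _ pu (i := i).
- by apply/Phi_opp/W_Phi => //; apply: word_W.
- by rewrite opprK.
by rewrite -ew => /(is_length_uniq wk) kj; exfalso; lia.
Qed.

(** Induction on [v], splitting off the letter s_i applied first: u(alpha_i) is positive and
    orthogonal to [ht], so [x] keeps it positive and s_i lengthens x u. *)
Lemma X_length_add (x : 'M[R]_n) p v q m : X x -> is_length x p -> is_length v q ->
  act v ht = ht -> is_length (v *m x) m -> (p + q <= m)%N.
Proof.
move=> xX xp; elim: q v m => [|q IH] v m vq vht vxm.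
  by move: vxm; rewrite (is_length0 vq) mul1mx addn0 => /(is_length_uniq xp) ->.
have [i [u [uq ev pu]]] := is_length_rS vq; have iP := al_Phi i.
have uW := is_length_W uq; have vW := is_length_W vq.
have [xW xpos] := iffLR (XIP x) xX.
have eu : act v (al i) = - act u (al i) by rewrite ev actM refl_root // actN.
(* [v] fixes [ht] but makes alpha_i negative, so dominance of [ht] gives (ht|alpha_i) <= 0. *)
have hi : '[ht, al i] = 0.
  apply/eqP; rewrite eq_le ht_dominant_al andbT -(W_sp _ _ vW) vht eu spNr.
  by rewrite oppr_le0 ht_dominant.
have uht : act u ht = ht.
  by move: vht; rewrite ev actM reflE // hi mulr0 mul0r scale0r subr0.
have [m' um'] := is_length_ex (W_mul uW xW).
have lm : (p + q <= m')%N by apply: IH um'.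
have : is_length (refl (al i) *m (u *m x)) m'.+1.
  apply: is_length_rup => //; rewrite actM; apply: xpos => //; first exact: W_Phi.
  by rewrite -{1}uht W_sp.
by rewrite mulmxA -ev => /(is_length_uniq vxm) ->; rewrite addnS.
Qed.

(** With a negative pairing, s_g would raise the level from [a] to [b]; with pairing 0 it would fix
    [b]. *)
Lemma root_arrow_gt0 g b a : g \in Phi -> pos g ->
  root_arrow cor Phi Q Delta ht g b a -> 0 < '[b, g].
Proof.
move=> gP pg [la lb ea eL]; case: (ltgtP '[b, g] 0) => // bg.
  have ag : 0 < '[a, g] by rewrite ea sp_refl // oppr_gt0.
  by have := level_lt la gP pg ag; rewrite {2}ea reflK // eL; lra.
by move: eL; rewrite ea reflE // bg mulr0 mul0r scale0r subr0; lra.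
Qed.

Lemma root_arrow_W_arrow a b g (xa xb : 'M[R]_n) : g \in Phi -> pos g ->
  X xa -> X xb -> act xa ht = a -> act xb ht = b ->
  root_arrow cor Phi Q Delta ht g b a <-> W_arrow cor Delta g xb xa.
Proof.
move=> gP pg Xa Xb ea eb; have [Wa _] := iffLR (XIP xa) Xa.
have [Wb _] := iffLR (XIP xb) Xb.
split=> [ar|[exa [k [bk ak]]]]; last first.
  split; rewrite -?ea -?eb ?W_ht_long //; first by rewrite exa actM.
  by rewrite (X_length_level Xa ak) (X_length_level Xb bk) -natr1.
have bg := root_arrow_gt0 gP pg ar; have [_ _ eab eL] := ar.
have [p ap] := is_length_ex Wa; have [q bq] := is_length_ex Wb.
have epq : p = q.+1.
  apply/eqP; rewrite -(eqr_nat R) -natr1 -(X_length_level Xa ap).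
  by rewrite -(X_length_level Xb bq) ea eb eL.
(* c = x_a^-1 g is negative because (ht|c) = (a|g) < 0, so exchange makes s_g x_a shorter than
   x_a. *)
have [c cP ec] := W_surj Wa gP.
have npc : pos (- c).
  rewrite posN //; apply/negP => /ht_dominant; rewrite -(W_sp _ _ Wa) ea ec eab.
  by rewrite sp_refl // leNgt oppr_lt0 bg.
have [|j jp xj] := is_length_exchange ap (Phi_opp cP) npc gP pg.
  by rewrite actN ec.
have [xb' [Wb' e1 e2]] := W_inv Wb.
have Wv : W (xa *m refl g *m xb') by apply: W_mul => //; apply: W_step.
have ev : xa *m refl g *m xb' *m xb = xa *m refl g by rewrite -mulmxA e2 mulmx1.
have vht : act (xa *m refl g *m xb') ht = ht.
  by rewrite !actM ea eab reflK // -eb -actM e1 act1.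
have [r vr] := is_length_ex Wv; move: xj; rewrite -ev => xj.
(* q + r <= j < q + 1 forces v = x_b^-1 s_g x_a to have length r = 0. *)
have := X_length_add Xb bq vr vht xj; move: jp; rewrite epq => jp qrj.
have r0 : r = 0%N by lia.
move: vr; rewrite r0 => /is_length0 v1; have exb : xa *m refl g = xb by rewrite -ev v1 mul1mx.
have exa : xa = xb *m refl g by rewrite -exb -mulmxA refl_invol ?mulmx1.
by split=> //; exists q; split; rewrite // -epq.
Qed.

(** * Paths and the Bruhat order *)

(* [path b a] is the relation [a \preceq b] of the paper. *)
Local Notation path b a := (root_prec cor Phi Q Delta ht a b).
(* The element of larger level among [x] and its image under the i-th simple reflection. *)
Local Notation raise i x := (if 0 < '[x, al i] then act (refl (al i)) x else x).

Lemma path_trans x y z : path x y -> path y z -> path x z.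
Proof. exact: rt_trans. Qed.

Lemma path_refl_al i x : long x -> 0 < '[x, al i] -> path x (act (refl (al i)) x).
Proof.
move=> lx xi; have iP := al_Phi i; apply: rt_step; exists (al i).
by split; rewrite ?al_pos //; split; rewrite ?long_refl // level_al.
Qed.

Lemma path_raise i x : long x -> path x (raise i x).
Proof. by move=> lx; case: ifP => xi; [apply: path_refl_al|apply: rt_refl]. Qed.

Lemma refl_comp a g x : a \in Phi -> g \in Phi ->
  act (refl a) (act (refl g) x) = act (refl (act (refl a) g)) (act (refl a) x).
Proof. by move=> aP gP; rewrite -!actM refl_conj //; apply: W_refl. Qed.

(** If s_i does not raise [x], extend the arrow by raising [y]. If g = alpha_i, both raised roots
    are [y]. Otherwise L(s_i x) = L(y) < L(s_i y), so s_i raises [y] too and the reflected pair is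
    an arrow. *)
Lemma arrow_raise i g x y : g \in Phi -> pos g ->
  root_arrow cor Phi Q Delta ht g x y -> path (raise i x) (raise i y).
Proof.
move=> gP pg ar; have xg := root_arrow_gt0 gP pg ar.
have [ly lx ey eL] := ar; have iP := al_Phi i.
have pxy : path x y by apply: rt_step; exists g.
case: (ltP 0 '[x, al i]) => xi; last exact: path_trans pxy (path_raise i ly).
case: (eqVneq g (al i)) => [eg|gi].
  by rewrite -eg -ey eg ey eg sp_refl ?al_Phi // oppr_gt0 ltNge ltW //; apply: rt_refl.
have pg' := pos_refl_al gP pg gi; have g'P := refl_Phi iP gP.
have lsx := long_refl iP lx; have lsy := long_refl iP ly.
have esy : act (refl (al i)) y =
    act (refl (act (refl (al i)) g)) (act (refl (al i)) x) by rewrite ey refl_comp.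
have lt_s : L (act (refl (al i)) x) < L (act (refl (al i)) y).
  by rewrite esy level_lt // W_sp //; apply: W_refl.
have ex := level_al lx xi; case: ltgtP => yi.
- have eys := level_al ly yi; apply: rt_step; exists (act (refl (al i)) g).
  by split=> //; split=> //; lra.
- have := level_al lsy (i := i); rewrite sp_refl ?al_Phi // oppr_gt0 reflK //.
  by move=> /(_ yi) eys; exfalso; lra.
- by move: lt_s; rewrite [act _ y]reflE // -yi mulr0 mul0r scale0r subr0; lra.
Qed.

Lemma path_raise2 i x y : path x y -> path (raise i x) (raise i y).
Proof.
elim=> [u v [g [gP pg]]|u|u v z _ IH1 _ IH2]; first exact: arrow_raise.
- exact: rt_refl.
- exact: path_trans IH1 IH2.
Qed.

Lemma path_refl b g : long b -> g \in Phi -> pos g -> 0 < '[b, g] ->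
  path b (act (refl g) b).
Proof.
move=> lb gP pg bg; have [k ek] := level_nat (long_refl gP lb).
elim: k b g lb gP pg bg ek => [|k IH] b g lb gP pg bg ek;
  have la := long_refl gP lb; have lt_ba := level_lt lb gP pg bg.
  by have [m em] := level_nat lb; move: lt_ba; rewrite em ek ltrn0.
have ag : '[act (refl g) b, g] < 0.
  by rewrite sp_refl // oppr_lt0.
(* A root pairing negatively with the positive root [g] does so with a simple root, and this s_i
   lowers its level. *)
have [i ai] : exists i, '[act (refl g) b, al i] < 0.
  apply/existsP; apply: contraLR ag; rewrite negb_exists => /forallP H.
  rewrite -leNgt sp_coord; apply: sumr_ge0 => j _.
  by rewrite mulr_ge0 ?pos_coord // leNgt.
have iP := al_Phi i; case: (eqVneq g (al i)) => [eg|gi].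
  by rewrite eg; apply: path_refl_al; rewrite -?eg.
have pg' := pos_refl_al gP pg gi; have g'P := refl_Phi iP gP.
have lb' := long_refl iP lb; have la' := long_refl iP la.
have a'i : 0 < '[act (refl (al i)) (act (refl g) b), al i].
  by rewrite sp_refl // oppr_gt0.
have eL := level_al la' a'i; rewrite reflK // ek -natr1 in eL.
have ea' := refl_comp b iP gP.
have pb'a' : path (act (refl (al i)) b) (act (refl (al i)) (act (refl g) b)).
  rewrite ea'; apply: IH => //; last by rewrite -ea'; lra.
  by rewrite W_sp //; apply: W_refl.
have pa'a := path_refl_al la' a'i; rewrite reflK // in pa'a.
(* If s_i lowers [b], raising both ends of the path restores [b] and s_g b. Otherwise go from [b] to
   s_i b, which equals [b] when the pairing is 0, then along the path and up to s_g b. *)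
case: (ltgtP '[b, al i] 0) => bi.
- by have := path_raise2 i pb'a'; rewrite a'i sp_refl ?al_Phi // oppr_gt0 bi !reflK.
- by apply: path_trans (path_refl_al lb bi) (path_trans pb'a' pa'a).
- move: pb'a'; rewrite [act (refl (al i)) b]reflE // bi mulr0 mul0r scale0r subr0.
  by move=> pb'a'; apply: path_trans pb'a' pa'a.
Qed.

(** The chain may leave [X]. For a step u to s_g u the root u^-1 g is positive, since exchange would
    otherwise shorten; hence (u(ht)|g) >= 0, and value 0 means that s_g fixes u(ht). *)
Lemma bruhat_le_path w w' :
  bruhat_le cor Phi Delta w w' -> path (act w ht) (act w' ht).
Proof.
elim=> [u v [g [gP pg [ev [k [uk vk]]]]]|u|u v z _ IH1 _ IH2].
- have uW := is_length_W uk; have [c cP ec] := W_surj uW gP.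
  have pc : pos c.
    apply: contraT => npc; have [|||j jk vj] := is_length_exchange uk (b := - c) _ _ gP pg.
    + exact: Phi_opp.
    + by rewrite posN.
    + by rewrite actN ec.
    by rewrite -ev in vj; have := is_length_uniq vj vk; lia.
  rewrite ev actM; have := ht_dominant pc; rewrite -(W_sp _ _ uW) ec le_eqVlt.
  case/predU1P=> [e|]; last by apply: path_refl => //; apply: W_ht_long.
  by rewrite reflE // -e mulr0 mul0r scale0r subr0; apply: rt_refl.
- exact: rt_refl.
- exact: path_trans IH1 IH2.
Qed.

Lemma path_long x y : path x y -> long x -> long y.
Proof. by elim=> [u v [g [_ _ []]]||u v z _ IH1 _ IH2 /IH1/IH2]. Qed.

(** Arrows lift one by one, the intermediate long roots being represented by [X_surj]. *)
Lemma path_bruhat_le b a : path b a -> forall x y : 'M[R]_n,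
  X x -> X y -> act x ht = b -> act y ht = a -> bruhat_le cor Phi Delta x y.
Proof.
elim=> [u v [g [gP pg ar]]|u|u v z p1 IH1 p2 IH2] x y Xx Xy ex ey.
- apply: rt_step; exists g; split=> //.
  exact: (iffLR (root_arrow_W_arrow gP pg Xy Xx ey ex)).
- by rewrite (X_inj Xx Xy) ?ex ?ey //; apply: rt_refl.
have lv : long v.
  by apply: path_long p1 _; rewrite -ex W_ht_long //; case: (iffLR (XIP x) Xx).
have [t Xt et] := X_surj lv.
exact: rt_trans (IH1 x t Xx Xt ex et) (IH2 t y Xt Xy et ey).
Qed.

(** * The integers attached to arrows *)

(** With k the pairing, s_g b = -b gives b = (k/2) g; reducedness and k > 0 force k = 2. *)
Lemma pairing_opp b a g : g \in Phi -> pos g -> b \in Phi ->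
  root_arrow cor Phi Q Delta ht g b a -> a = - b -> cpair cor b g = 2.
Proof.
move=> gP pg bP ar eNb; have bg := root_arrow_gt0 gP pg ar.
have [_ _ ea _] := ar; move: bg ea; rewrite eNb reflE // cpairE // => bg.
have k0 : 0 < 2 * '[b, g] / '[g, g] by rewrite divr_gt0 ?mulr_gt0 // sp_root.
move: (2 * _ / _) k0 => k k0 e.
have eb : b = (k / 2) *: g.
  have : 2 *: b = k *: g by rewrite -(subKr b (k *: g)) -e opprK scaler_nat mulr2n.
  by move/(congr1 ( *:%R 2^-1)); rewrite !scalerA mulVf ?pnatr_eq0 // scale1r mulrC.
by have := redP (c := k / 2) gP; rewrite -eb => /(_ bP)[]; lra.
Qed.

Lemma pairing_sub b a g : g \in Phi -> pos g ->
  root_arrow cor Phi Q Delta ht g b a -> b - a \in Phi -> cpair cor b g = 1.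
Proof.
move=> gP pg ar; have bg := root_arrow_gt0 gP pg ar.
have [_ _ -> _] := ar; rewrite reflE // cpairE // subKr.
have k0 : 0 < 2 * '[b, g] / '[g, g] by rewrite divr_gt0 ?mulr_gt0 // sp_root.
by move=> /(redP gP)[]; lra.
Qed.

Lemma pairing_neq b g : long b -> g \in Phi -> 0 < '[b, g] -> b != g ->
  cpair cor b g = rmax / '[g, g].
Proof.
move=> lb gP bg neq; rewrite cpairE // (long_pairing lb) //.
by apply: contraTneq bg => ->; rewrite spNl -leNgt oppr_le0 ltW // sp_root.
Qed.

(** The level rises by 2 [htv b] - 1 from [b] to -b, which equals 1 only if [htv b] = 1, that is, if
    [b] is simple. *)
Lemma root_arrow_self b a : pos b ->
  root_arrow cor Phi Q Delta ht b b a -> [/\ a = - b & exists i, b = al i].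
Proof.
move=> pb [_ lb]; rewrite refl_root ?long_Phi // => -> eL; split=> //.
case: (htv_long_pos lb pb) => // hb; move: eL.
by rewrite /level pb posN ?long_Phi // pb htvN /=; lra.
Qed.

End LongRoots.

Theorem theorem1p14 (R : realFieldType) (n : nat)
  (cor : 'rV[R]_n -> 'cV[R]_n) (Phi : seq 'rV[R]_n) (Q : 'M[R]_n)
  (Delta : n.-tuple 'rV[R]_n) (ht : 'rV[R]_n) :
  root_system cor Phi -> reduced_rs Phi -> irreducible_rs cor Phi ->
  W_invariant_scalar_product cor Phi Q -> min_sp_one Phi Q ->
  simple_basis Phi Delta -> highest_root Phi Delta ht ->
  let L := level Phi Q Delta ht in
  let lg := longb Phi Q in
  let X := XI cor Phi Q Delta ht in
  (* bijection X_I -> Phi_lg, x |-> x(ht) *)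
  (forall x, X x -> lg (act x ht)) /\
  (forall a, lg a -> exists2 x, X x & act x ht = a) /\
  (forall x y, X x -> X y -> act x ht = act y ht -> x = y) /\
  (* anti-isomorphism of posets *)
  (forall x y, X x -> X y ->
     (bruhat_le cor Phi Delta x y <->
      root_prec cor Phi Q Delta ht (act y ht) (act x ht))) /\
  (* level i <-> length i *)
  (forall x k, X x -> is_length cor Delta x k -> L (act x ht) = k%:R) /\
  (* arrows correspond *)
  (forall a b g xa xb, lg a -> lg b -> g \in Phi -> posb Delta g ->
     X xa -> X xb -> act xa ht = a -> act xb ht = b ->
     (root_arrow cor Phi Q Delta ht g b a <-> W_arrow cor Delta g xb xa)) /\
  (* the integers partial_{alpha beta} = <beta, gamma^vee> *)
  (forall a b g, lg a -> lg b -> g \in Phi -> posb Delta g ->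
     root_arrow cor Phi Q Delta ht g b a ->
     if Delta_lg Phi Q Delta b && Delta_lg Phi Q Delta (- a) then
       (a = - b -> cpair cor b g = 2) /\ (b - a \in Phi -> cpair cor b g = 1)
     else
       (lg g -> cpair cor b g = 1) /\ (~~ lg g -> cpair cor b g = rmax Phi Q)).
Proof.
move=> rsP redP irrP QP minP baseP htP L lg X.
split; first by move=> x Xx; case: (iffLR (XIP rsP QP baseP htP x) Xx) => Wx _;
  apply: (W_ht_long rsP redP QP minP baseP htP).
split; first by move=> a; apply: (X_surj rsP redP QP minP baseP htP).
split; first by move=> x y; apply: (X_inj rsP redP QP baseP htP).
split.
  move=> x y Xx Xy; split=> [|p].
    by apply: (bruhat_le_path rsP redP irrP QP minP baseP htP).
  by apply: (path_bruhat_le rsP redP irrP QP minP baseP htP p).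
split; first by move=> x k; apply: (X_length_level rsP redP irrP QP minP baseP htP).
split.
  move=> a b g xa xb _ _ gP pg.
  by apply: (root_arrow_W_arrow rsP redP irrP QP minP baseP htP gP pg).
move=> a b g la lb gP pg ar; have bP := long_Phi lb.
have bg := root_arrow_gt0 rsP redP irrP QP minP baseP gP pg ar.
case: ifP => simple; split.
- by apply: (pairing_opp rsP redP irrP QP minP baseP gP pg bP ar).
- by apply: (pairing_sub rsP redP irrP QP minP baseP gP pg ar).
(* For b = g the arrow goes from [b] to -b with [b] simple and long, which belongs to the other
   case. *)
- move=> lg_g; case: (eqVneq b g) => [ebg|neq].
    have ar' : root_arrow cor Phi Q Delta ht b b a by rewrite {1}ebg.
    have pb : posb Delta b by rewrite ebg.
    have [ea [i ei]] := root_arrow_self rsP redP irrP QP minP baseP pb ar'.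
    by rewrite ea opprK andbb /Delta_lg ei mem_tnth -ei (lb : longb Phi Q b) in simple.
  rewrite (pairing_neq rsP redP QP minP lb gP bg neq) (long_sp lg_g) divff //.
  by rewrite gt_eqF // (rmax_gt0 rsP QP minP).
move=> short_g; have neq : b != g by apply: contraNneq short_g => <-.
rewrite (pairing_neq rsP redP QP minP lb gP bg neq).
by rewrite (short_length rsP redP irrP QP minP gP short_g) divr1.
Qed.
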